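(* Let $q = p^r$ be a prime power ($p$ prime, $r \ge 1$), let $n \ge 1$ be an integer, and let $d$ be an integer with $d \ge q-1$. Let $X_{n,d} : \mathbb{F}_q[x_1, \ldots, x_n]_{(d,\ldots,d)} \to \mathbb{N}$ be the random variable whose value is the number of distinct zeros in $\mathbb{F}_q^n$ of a uniformly random polynomial $f \in \mathbb{F}_q[x_1,\ldots,x_n]_{(d,\ldots,d)}$. Then the probability generating function of $X_{n,d}$ is $$\Phi_{n,d}(t) := \sum_{k \ge 0} P(X_{n,d} = k)\, t^k = \left(1 + \frac{t-1}{q}\right)^{q^n}.$$
   Context: $\mathbb{F}_q$ is the finite field with $q$ elements. For $d \ge 0$, $\mathbb{F}_q[x_1,\ldots,x_n]_{(d,\ldots,d)}$ denotes the set of polynomials in $n$ variables over $\mathbb{F}_q$ whose degree in each variable $x_i$ is at most $d$ (including the zero polynomial); it is an $\mathbb{F}_q$-vector space of dimension $(d+1)^n$. A random polynomial is chosen uniformly from this finite set (equivalently, its coefficients are chosen independently and uniformly). A zero of $f$ is a point $\mathbf{p} \in \mathbb{F}_q^n$ with $f(\mathbf{p}) = 0$; zeros are counted without multiplicity. *)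

(* Defs.v *)
From HB Require Import structures.
From mathcomp Require Import all_boot all_order all_algebra.
From mathcomp Require Import mpoly.

Set Implicit Arguments.
Unset Strict Implicit.
Unset Printing Implicit Defensive.
Import GRing.Theory.
Local Open Scope ring_scope.

(* The degree of the zero polynomial is 0 here, not -oo; this is harmless for
   upper bounds on degrees. *)
Definition degvar (n : nat) (R : nzRingType) (i : 'I_n) (f : {mpoly R[n]}) : nat :=
  \max_(m <- msupp f) m i.

Record bmpoly (n d : nat) (R : nzRingType) := BMPoly {
  bmpoly_val :> {mpoly R[n]};
  _ : [forall i, degvar i bmpoly_val <= d]%N
}.

HB.instance Definition _ n d R := [isSub for @bmpoly_val n d R].
HB.instance Definition _ n d R := [Choice of bmpoly n d R by <:].

(* A polynomial of degree at most d in each variable is determined by its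
   coefficients at the monomials with exponents in {0, ..., d}; this makes
   bmpoly n d F finite when F is. *)
Section Finiteness.
Variables (n d : nat) (F : finNzRingType).

Definition box_mnm (e : {ffun 'I_n -> 'I_d.+1}) : 'X_{1..n} :=
  [multinom (e i : nat) | i < n].

Definition bmpoly_coefs (f : bmpoly n d F) :
    {ffun {ffun 'I_n -> 'I_d.+1} -> F} := [ffun e => f@_(box_mnm e)].

Definition bmpoly_of_coefs (c : {ffun {ffun 'I_n -> 'I_d.+1} -> F}) :
    option (bmpoly n d F) := insub (\sum_e c e *: 'X_[box_mnm e]).

Lemma box_mnm_inj : injective box_mnm.
Proof.
move=> e1 e2 /mnmP e12; apply/ffunP => i; apply: val_inj.
by have := e12 i; rewrite !mnmE.
Qed.

Lemma bmpoly_coefsK : pcancel bmpoly_coefs bmpoly_of_coefs.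
Proof.
move=> f; suff E : \sum_e bmpoly_coefs f e *: 'X_[box_mnm e] = val f.
  by rewrite /bmpoly_of_coefs E valK.
apply/mpolyP => m; rewrite raddf_sum /=.
under eq_bigr => e _ do rewrite ffunE mcoeffZ mcoeffX.
have [/forallP md|/forallPn[i]] := boolP [forall i, m i <= d]%N; last first.
  rewrite -ltnNge => lt_d_mi; rewrite big1 => [|e _]; last first.
    case: eqP => [em|_]; last by rewrite mulr0.
    by move: lt_d_mi; rewrite -em mnmE ltnNge -ltnS ltn_ord.
  apply/esym/eqP; rewrite mcoeff_eq0; apply/negP => mf.
  case: f mf => f /= /forallP /(_ i) le_d mf.
  have le_mi : (m i <= degvar i f)%N by exact: (leq_bigmax_seq _ mf).
  by move: (leq_trans le_mi le_d); rewrite leqNgt lt_d_mi.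
pose e0 : {ffun 'I_n -> 'I_d.+1} := [ffun i => inord (m i)].
have e0m : box_mnm e0 = m.
  by apply/mnmP => i; rewrite mnmE ffunE inordK // ltnS.
rewrite (bigD1 e0) //= e0m eqxx mulr1 big1 ?addr0 // => e ne_e.
by rewrite -e0m (inj_eq box_mnm_inj) (negPf ne_e) mulr0.
Qed.

HB.instance Definition _ := PCanIsCountable bmpoly_coefsK.
HB.instance Definition _ := isFinite.Build (bmpoly n d F)
  (pcan_enumP bmpoly_coefsK).

End Finiteness.

Definition nb_zeros (n : nat) (F : finFieldType) (f : {mpoly F[n]}) : nat :=
  #|[set v : {ffun 'I_n -> F} | f.@[v] == 0]|.

Definition unif_prob (R : numFieldType) (T : finType) (E : {set T}) : R :=
  #|E|%:R / #|T|%:R.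

(* Main.v *)
Require Import Defs.
From HB Require Import structures.
From mathcomp Require Import all_boot all_order all_algebra.
From mathcomp Require Import finfield.
From mathcomp Require Import mpoly.
From mathcomp Require Import classical_sets reals topology normedtype sequences.
Set Implicit Arguments.
Unset Strict Implicit.
Unset Printing Implicit Defensive.
Import GRing.Theory Num.Theory numFieldNormedType.Exports.
Local Open Scope classical_set_scope.
Local Open Scope ring_scope.

(** Write q for the cardinality of F. Evaluation sends a polynomial to a
    function from F^n to F. It is additive, and it is surjective as soon as
    d >= q - 1: the univariate polynomial 1 - (X - a)^(q-1) is the indicator of
    a on F, products of such polynomials are the indicators of the points of
    F^n, and these have degree q - 1 in each variable. Hence a uniformly random
    polynomial evaluates to a uniformly random function, that is, its values at
    the q^n points are independent and uniform in F. Each value vanishes with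
    probability 1/q, so the number of zeros is a sum of q^n independent
    Bernoulli variables, whose generating function is (1 + (t - 1)/q)^(q^n).

    The uniformity is [sum_evalfun]: adding a fixed polynomial permutes the
    bounded polynomials, so averaging over all target functions lets evaluation
    be replaced by a uniform function. Surjectivity is [evalfun_surj], and the
    product structure of the space of functions gives [sum_zeros_ffun]. The
    series has finitely many nonzero terms, and its partial sums are eventually
    equal to the mean of t^(number of zeros) ([sum_unif_prob_exp]). *)

Lemma degvar_leP (n d : nat) (R : nzRingType) (i : 'I_n) (f : {mpoly R[n]}) :
  reflect (forall m, m \in msupp f -> (m i <= d)%N) (degvar i f <= d)%N.
Proof.
apply: (iffP (bigmax_leqP_seq _ _ _ _)) => [h m mf|h m mf _]; last exact: h.
exact: h.
Qed.

Lemma degvarD (n d : nat) (R : nzRingType) (i : 'I_n) (f g : {mpoly R[n]}) :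
  (degvar i f <= d)%N -> (degvar i g <= d)%N -> (degvar i (f + g) <= d)%N.
Proof.
move=> /degvar_leP fd /degvar_leP gd; apply/degvar_leP => m /msuppD_le.
by rewrite mem_cat => /orP[/fd|/gd].
Qed.

Lemma bmpolyD_subproof (n d : nat) (R : nzRingType) (f g : bmpoly n d R) :
  [forall i, degvar i (val f + val g) <= d]%N.
Proof.
by apply/forallP => i; apply: degvarD; [case: f|case: g] => h /= /forallP.
Qed.

Definition bmpolyD {n d : nat} {R : nzRingType} (f g : bmpoly n d R) :
  bmpoly n d R := BMPoly (bmpolyD_subproof f g).

Lemma bmpolyD_inj (n d : nat) (R : nzRingType) (g : bmpoly n d R) :
  injective (bmpolyD^~ g).
Proof. by move=> f1 f2 /(congr1 val) /= /addIr /val_inj. Qed.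

Lemma box_bmpoly_subproof (n d : nat) (F : finNzRingType)
    (c : {ffun 'I_n -> 'I_d.+1} -> F) :
  [forall i, degvar i (\sum_e c e *: 'X_[box_mnm e] : {mpoly F[n]}) <= d]%N.
Proof.
apply/forallP => i.
apply: (big_ind (fun f : {mpoly F[n]} => (degvar i f <= d)%N)).
- by rewrite /degvar msupp0 big_nil.
- by move=> f g; apply: degvarD.
move=> e _; apply/degvar_leP => m /msuppZ_le.
by rewrite msuppX inE => /eqP ->; rewrite mnmE -ltnS.
Qed.

Definition box_bmpoly {n d : nat} {F : finNzRingType}
    (c : {ffun 'I_n -> 'I_d.+1} -> F) : bmpoly n d F :=
  BMPoly (box_bmpoly_subproof c).

Definition evalfun {n : nat} {F : finFieldType} (f : {mpoly F[n]}) :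
  {ffun {ffun 'I_n -> F} -> F} := [ffun v : {ffun 'I_n -> F} => f.@[v]].

Definition point_poly {F : finFieldType} (a : F) : {poly F} :=
  1 - ('X - a%:P) ^+ #|F|.-1.

Lemma size_point_poly (F : finFieldType) (a : F) :
  (size (point_poly a) <= #|F|)%N.
Proof.
have F_gt0 : (0 < #|F|)%N by apply/card_gt0P; exists 0.
rewrite (leq_trans (size_polyD _ _)) // size_polyN size_poly1 size_exp_XsubC.
by rewrite prednK // geq_max F_gt0 leqnn.
Qed.

(** By Fermat's little theorem in F, a power (b - a)^(q-1) is 1 unless
    b = a. *)
Lemma horner_point_poly (F : finFieldType) (a b : F) :
  (point_poly a).[b] = (a == b)%:R.
Proof.
have F_gt1 : (1 < #|F|)%N by exact: finNzRing_gt1.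
rewrite /point_poly hornerD hornerN hornerC horner_exp hornerXsubC.
case: eqVneq => [->|ne_ab].
  by rewrite subrr expr0n -subn1 subn_eq0 leqNgt F_gt1 subr0.
have ba_neq0 : b - a != 0 by rewrite subr_eq0 eq_sym.
suff -> : (b - a) ^+ #|F|.-1 = 1 by rewrite subrr.
apply: (mulfI ba_neq0); rewrite -exprS prednK ?mulr1 ?expf_card //.
exact: ltnW.
Qed.

(** The interpolating polynomial is the combination, weighted by the values of
    g, of the indicators of the points v, where the indicator of v is the
    product over i of [point_poly (v i)] in the i-th variable. It is given here
    by its coefficients, which makes the degree bounds immediate. *)
Lemma evalfun_surj (n d : nat) (F : finFieldType)
    (g : {ffun {ffun 'I_n -> F} -> F}) :
  (#|F| - 1 <= d)%N -> exists f : bmpoly n d F, evalfun f = g.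
Proof.
move=> le_Fd.
have le_F_dS : (#|F| <= d.+1)%N by rewrite -add1n -leq_subLR.
exists (box_bmpoly (fun e : {ffun 'I_n -> 'I_d.+1} =>
  \sum_v g v * \prod_i (point_poly (v i))`_(e i))).
apply/ffunP => w; rewrite ffunE /= raddf_sum /=.
transitivity (\sum_v g v * \prod_i (point_poly (v i)).[w i]).
  under eq_bigr => e _ do rewrite mevalZ mulr_suml.
  rewrite exchange_big /=; apply: eq_bigr => v _.
  under [in RHS]eq_bigr => i _ do
    rewrite (horner_coef_wide _ (leq_trans (size_point_poly _) le_F_dS)).
  rewrite bigA_distr_bigA mulr_sumr; apply: eq_bigr => e _.
  rewrite -mulrA big_split /= mevalX; congr (_ * (_ * _)).
  by apply: eq_bigr => i _; rewrite mnmE.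
rewrite (bigD1 w) //= [X in _ + X]big1 ?addr0 => [|v ne_vw].
  by rewrite big1 ?mulr1 // => i _; rewrite horner_point_poly eqxx.
have [i ne_i] : exists i, v i != w i.
  apply/existsP; rewrite -negb_forall; apply: contraNN ne_vw => /forallP vw.
  by apply/eqP/ffunP => i; apply/eqP.
by rewrite (bigD1 i) //= horner_point_poly (negPf ne_i) mul0r mulr0.
Qed.

(** Adding a preimage of g permutes the bounded polynomials and translates
    evaluation by g, so the sum of h over evaluations is unchanged by the
    translation. Summing over g as well and exchanging the two sums, the
    translates of each evaluation run through all functions once. *)
Lemma sum_evalfun (R : comNzRingType) (n d : nat) (F : finFieldType)
    (h : {ffun {ffun 'I_n -> F} -> F} -> R) :
  (#|F| - 1 <= d)%N ->
  #|{ffun {ffun 'I_n -> F} -> F}|%:R * (\sum_(f : bmpoly n d F) h (evalfun f))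
  = #|{: bmpoly n d F}|%:R * \sum_g h g.
Proof.
move=> le_Fd; rewrite -!sum1_card !natr_sum !mulr_suml.
transitivity (\sum_(g : {ffun {ffun 'I_n -> F} -> F})
    \sum_(f : bmpoly n d F) h (evalfun f + g)).
  apply: eq_bigr => g _; rewrite mul1r.
  have [f0 <-] := evalfun_surj g le_Fd.
  rewrite (reindex_inj (@bmpolyD_inj _ _ _ f0)) /=.
  apply: eq_bigr => f _; congr h.
  by apply/ffunP => v; rewrite !ffunE mevalD.
rewrite exchange_big /=; apply: eq_bigr => f _.
by rewrite mul1r [RHS](reindex_inj (addrI (evalfun f))).
Qed.

(** The factor t is collected once per zero, so the summand is a product over
    the points and the sum over all functions factors into equal sums over
    the possible values at each point. *)
Lemma sum_zeros_ffun (R : comNzRingType) (T : finType) (F : finNzRingType)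
    (t : R) :
  \sum_(g : {ffun T -> F}) t ^+ #|[set v | g v == 0]%SET|
  = (#|F|%:R + (t - 1)) ^+ #|T|.
Proof.
have F_gt0 : (0 < #|F|)%N by apply/card_gt0P; exists 0.
transitivity (\sum_(g : {ffun T -> F}) \prod_v (if g v == 0 then t else 1)).
  apply: eq_bigr => g _; rewrite -big_mkcond /= prodr_const.
  by congr (_ ^+ _); apply: eq_card => v; rewrite !inE.
rewrite -(bigA_distr_bigA (fun _ a => if a == 0 then t else 1)) /=.
rewrite prodr_const; congr (_ ^+ _).
rewrite (bigD1 0) //= eqxx (eq_bigr (fun=> 1)) => [|a /negPf -> //].
rewrite sumr_const cardC1 -[in RHS](prednK F_gt0) -natr1.
by rewrite addrACA subrr addr0 addrC.
Qed.

Lemma sum_unif_prob_exp (R : numFieldType) (T : finType) (X : T -> nat)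
    (t : R) (N : nat) :
  (forall x, X x < N)%N ->
  \sum_(0 <= k < N) unif_prob R [set x | X x == k]%SET * t ^+ k
  = (\sum_x t ^+ X x) / #|T|%:R.
Proof.
move=> ltXN; rewrite mulr_suml.
transitivity (\sum_(0 <= k < N) \sum_x ((X x == k)%:R * t ^+ k / #|T|%:R : R)).
  apply: eq_bigr => k _; rewrite /unif_prob mulrAC -2!mulr_suml.
  congr (_ * _ / _); rewrite -sum1_card natr_sum big_mkcond /=.
  by apply: eq_bigr => x _; rewrite inE; case: eqP.
rewrite exchange_big /=; apply: eq_bigr => x _.
rewrite big_mkord (bigD1 (Ordinal (ltXN x))) //= eqxx mul1r big1 ?addr0 //.
move=> k ne_k; rewrite [X x == k]eq_sym.
by rewrite -[X x]/(val (Ordinal (ltXN x))) (inj_eq val_inj) (negPf ne_k) !mul0r.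
Qed.

Theorem theorem1p1 (R : realType) (p r q n d : nat) (F : finFieldType)
    (p_prime : prime p) (r_ge1 : (1 <= r)%N) (q_def : q = (p ^ r)%N)
    (cardF : #|F| = q) (n_ge1 : (1 <= n)%N) (d_ge : (q - 1 <= d)%N) (t : R) :
  series (fun k : nat =>
      unif_prob R [set f : bmpoly n d F | nb_zeros f == k]%SET * t ^+ k) @ \oo
    --> (1 + (t - 1) / q%:R) ^+ (q ^ n).
Proof.
apply: cvg_near_cst; exists (q ^ n).+1 => // N /= leqN.
have cardV : #|{ffun 'I_n -> F}| = (q ^ n)%N by rewrite card_ffun card_ord cardF.
rewrite /series /= sum_unif_prob_exp => [|f]; last first.
  by apply: leq_ltn_trans leqN; rewrite -cardV max_card.
have q_neq0 : q%:R != 0 :> R.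
  by rewrite pnatr_eq0 q_def -lt0n expn_gt0 prime_gt0.
have B_neq0 : #|{: bmpoly n d F}|%:R != 0 :> R.
  rewrite pnatr_eq0 -lt0n; apply/card_gt0P.
  by exists (box_bmpoly (fun=> 0)).
have zerosE (f : bmpoly n d F) :
    nb_zeros f = #|[set v | evalfun f v == 0]%SET|.
  by apply: eq_card => v; rewrite !inE ffunE.
under eq_bigr => f _ do rewrite zerosE.
rewrite -cardF in d_ge.
have := @sum_evalfun _ n _ _
  (fun g => t ^+ #|[set v | g v == 0]%SET|) d_ge.
rewrite sum_zeros_ffun card_ffun cardV cardF natrX => sumE.
have qn_neq0 : q%:R ^+ (q ^ n) != 0 :> R by rewrite expf_neq0.
apply: (mulfI qn_neq0); rewrite mulrA sumE mulrAC divff // mul1r -exprMn.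
by rewrite mulrDr mulr1 mulrCA divff // mulr1.
Qed.
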